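(* There exists an absolute constant $C$ such that the following holds. Suppose that $\overline{\dim}_{\mathrm M}(A)>\frac{C}{\delta}\log\left(\frac1\delta\right)$ for some bounded set $A\subset\mathbb{R}^n$ and $\delta>0$. Then $A$ contains angles from the interval $(60^\circ-\delta,60^\circ]$ and also from $[60^\circ,60^\circ+\delta)$. Therefore $\widetilde{C}(60^\circ,\delta)\le\frac{C}{\delta}\log\left(\frac1\delta\right)$.
   Context: A set $A\subset\mathbb{R}^n$ contains the angle $\alpha\in[0,180^\circ]$ if there exist distinct points $x,y,z\in A$ such that the angle between the vectors $y-x$ and $z-x$ is $\alpha$. Let $\dim$ denote Hausdorff dimension. For $\alpha\in[0,180^\circ]$ and $\delta>0$ define $$\widetilde{C}(\alpha,\delta)=\sup\{\dim(A) : A\subset\mathbb{R}^n \text{ for some } n;\ A \text{ does not contain any angle from } (\alpha-\delta,\alpha+\delta)\},$$ where $A$ is an arbitrary set and $n$ is not fixed. The constant $C$ does not depend on $n$, $A$ or $\delta$. For a nonempty bounded $A\subset\mathbb{R}^n$ let $P(A,\varepsilon)$ be the greatest integer $k$ for which there exist $k$ pairwise disjoint closed balls of radius $\varepsilon$ with centers in $A$. The upper Minkowski dimension of $A$ is $\overline{\dim}_{\mathrm M}(A)=\sup\{s:\limsup_{\varepsilon\to0+}P(A,\varepsilon)\varepsilon^s=\infty\}$.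
   Formalization: The claim fails for δ near or above 1 (at δ=1 the bound is 0, yet [0,1]⊂R has dimension 1 and only the angles 0° and 180°), so it is proved for 0<δ≤δ0 with any fixed δ0<1, C depending only on δ0; angles and δ are in radians. *)

(* Defs.v *)
From HB Require Import structures.
From mathcomp Require Export all_boot all_order all_algebra.
From mathcomp Require Export all_classical all_reals all_analysis.

Set Implicit Arguments.
Unset Strict Implicit.
Unset Printing Implicit Defensive.

Export Order.TTheory GRing.Theory Num.Theory.
Export numFieldNormedType.Exports.

#[global] Open Scope classical_set_scope.
#[global] Open Scope ring_scope.

(* The library norm on 'rV[R]_n is the sup norm, so the Euclidean structure
   is set up here. *)
Definition edot (R : realType) (n : nat) (u v : 'rV[R]_n) : R :=
  \sum_(i < n) u ord0 i * v ord0 i.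

Definition enorm (R : realType) (n : nat) (u : 'rV[R]_n) : R :=
  Num.sqrt (edot u u).

Definition eucl_dist (R : realType) (n : nat) (x y : 'rV[R]_n) : R := enorm (x - y).

Definition eclosed_ball (R : realType) (n : nat) (x : 'rV[R]_n) (r : R) :
    set 'rV[R]_n :=
  [set y | eucl_dist x y <= r].

(* In radians, with values in [0, pi]; only meaningful for nonzero vectors. *)
Definition angle (R : realType) (n : nat) (u v : 'rV[R]_n) : R :=
  acos (edot u v / (enorm u * enorm v)).

Definition contains_angle (R : realType) (n : nat) (A : set 'rV[R]_n)
    (alpha : R) : Prop :=
  exists x y z : 'rV[R]_n,
    [/\ A x, A y & A z] /\ [/\ x <> y, x <> z & y <> z] /\
    angle (y - x) (z - x) = alpha.

Definition ediam (R : realType) (n : nat) (U : set 'rV[R]_n) : \bar R :=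
  ereal_sup [set d | exists x y, [/\ U x, U y & d = (eucl_dist x y)%:E]].

(* diam(U)^s, with 0^0 = 1 for nonempty U; the empty set is treated apart so
   that it contributes 0 for every s, including s = 0. *)
Definition hausdorff_gauge (R : realType) (n : nat) (s : R)
    (U : set 'rV[R]_n) : \bar R :=
  if U == set0 then 0%E else poweR (ediam U) s.

Definition hausdorff_premeasure (R : realType) (n : nat) (s eta : R)
    (A : set 'rV[R]_n) : \bar R :=
  ereal_inf [set t | exists U : nat -> set 'rV[R]_n,
    [/\ A `<=` \bigcup_i U i,
        (forall i, (ediam (U i) <= eta%:E)%E) &
        t = (\sum_(0 <= i <oo) hausdorff_gauge s (U i))%E]].

Definition hausdorff_measure (R : realType) (n : nat) (s : R)
    (A : set 'rV[R]_n) : \bar R :=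
  ereal_sup [set hausdorff_premeasure s eta A | eta in [set eta : R | 0 < eta]].

Definition hausdorff_dim (R : realType) (n : nat) (A : set 'rV[R]_n) : \bar R :=
  ereal_inf [set s%:E | s in [set s : R | 0 <= s /\ hausdorff_measure s A = 0%E]].

Definition has_packing (R : realType) (n : nat) (A : set 'rV[R]_n) (eps : R)
    (k : nat) : Prop :=
  exists x : 'I_k -> 'rV[R]_n,
    (forall i, A (x i)) /\
    (forall i j, i != j ->
      eclosed_ball (x i) eps `&` eclosed_ball (x j) eps = set0).

(* For bounded A and eps > 0 the supremum is the greatest such integer k. *)
Definition packing_number (R : realType) (n : nat) (A : set 'rV[R]_n)
    (eps : R) : \bar R :=
  ereal_sup [set (k%:R)%:E | k in [set k : nat | has_packing A eps k]].

(* The exponent s ranges over all of R, so that a nonempty finite set has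
   dimension 0; the value at the empty set is the junk value -oo. *)
Definition upper_minkowski_dim (R : realType) (n : nat) (A : set 'rV[R]_n) :
    \bar R :=
  ereal_sup [set s%:E | s in [set s : R |
    limf_esup (fun eps : R => packing_number A eps * (eps `^ s)%:E)%E (0 : R)^'+
      = +oo%E]].

(* The supremum runs over all dimensions n and all subsets of R^n. *)
Definition Ctilde (R : realType) (alpha delta : R) : \bar R :=
  ereal_sup [set d | exists (n : nat) (A : set 'rV[R]_n),
    (forall theta, alpha - delta < theta < alpha + delta ->
       ~ contains_angle A theta) /\
    d = hausdorff_dim A].

(* Main.v *)
Require Import Defs.
From mathcomp Require Import ring lra zify.

(** A triangle whose side lengths agree up to a factor 1 + k, with k a small
    multiple of delta, has all its angles within delta of pi/3; the one opposite
    the shortest side is at most pi/3 and the one opposite the longest side is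
    at least pi/3.  So it suffices to find such a triangle in A.

    If A has none, take points of A in a ball of radius r that are pairwise more
    than r/2 apart, and colour each pair by the power of 1 + k just below its
    distance divided by r/2.  All distances lie in [r/2, 2r], so K = O(1/delta)
    colours suffice, and no triangle is monochromatic.  By Ramsey's theorem for
    triangles there are at most M = (K+1)^K such points, hence r/2-balls around
    M points cover the part of A in the ball.  Iterating, M^j balls of radius
    r/2^j suffice for every j, which bounds the upper Minkowski dimension of
    bounded pieces of A, and the Hausdorff dimension of A, by
    log_2 M = O((1/delta) log(1/delta)). *)

Set Implicit Arguments.
Unset Strict Implicit.
Unset Printing Implicit Defensive.

(** * Ramsey's theorem for triangles in several colours *)

(** Induction on the number of colours in [D]: the neighbours of a vertex [x0] along colour [d] span
    no edge of colour [d], so each of the [#|D|] neighbour classes falls under the case [D :\ d].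
    With the base [K.+1] kept fixed, the recursion closes because [1 + #|D| * b <= K.+1 * b] for
    [b = K.+1 ^ #|D|.-1]. *)
Lemma multicolor_ramsey_triangle (T : finType) (K : nat) (c : T -> T -> 'I_K)
    (D : {set 'I_K}) (S : {set T}) :
  {in S &, forall x y, x != y -> c x y \in D} ->
  (forall x y z, [/\ x != y, x != z & y != z] -> c x y = c x z ->
    c y z <> c x y) ->
  (#|S| <= K.+1 ^ #|D|)%N.
Proof.
have [m] := ubnP #|D|; elim: m => // m IH in D S *.
rewrite ltnS => leDm cD notri.
case: (set_0Vmem S) => [->|[x0 x0S]]; first by rewrite cards0.
pose P d := [set y in S | (y != x0) && (c x0 y == d)].
have S1 : S :\ x0 = (\bigcup_(d in D) P d)%SET.
  apply/setP => y; rewrite !inE; apply/andP/bigcupP => [[ny yS]|[d dD]].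
    by exists (c x0 y); rewrite ?cD 1?eq_sym// inE yS ny eqxx.
  by rewrite inE => /andP[-> /andP[-> _]].
have cardP d : d \in D -> (#|P d| <= K.+1 ^ #|D|.-1)%N.
  move=> dD; have -> : #|D|.-1 = #|D :\ d| by rewrite (cardsD1 d D) dD.
  apply: IH => //; first by rewrite (cardsD1 d D) dD in leDm.
  move=> y z; rewrite !inE => /andP[yS /andP[ny /eqP cy]].
  move=> /andP[zS /andP[nz /eqP cz]] yz; rewrite cD // andbT.
  apply/eqP => cyz; apply: (notri x0 y z); last by rewrite cyz.
    by split => //; rewrite eq_sym.
  by rewrite cy.
rewrite (cardsD1 x0 S) x0S S1.
have leB : (#|(\bigcup_(d in D) P d)%SET| <= #|D| * K.+1 ^ #|D|.-1)%N.
  apply: (@leq_trans (\sum_(d in D) #|P d|)).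
    elim/big_ind2 : _ => [|A a B b hA hB|//]; first by rewrite cards0.
    by rewrite (leq_trans (leq_card_setU _ _)) // leq_add.
  by rewrite -sum_nat_const leq_sum.
(* Without colours there are no neighbours and [S] reduces to [x0]. *)
have [D0|D0] := posnP #|D|.
  by move: leB; rewrite D0 mul0n expn0 leqn0 => /eqP ->.
have DK : (#|D| <= K)%N by rewrite -[leqRHS](card_ord K) max_card.
rewrite -[X in (_ <= K.+1 ^ X)%N](prednK D0) expnS mulSn leq_add ?expn_gt0//.
by apply: leq_trans leB _; rewrite leq_mul2r DK orbT.
Qed.

(** * Euclidean norm, distance and balls *)

Section euclidean.
Context (R : realType) (n : nat).
Implicit Types u v x y z : 'rV[R]_n.

Lemma edot_ge0 u : 0 <= edot u u.
Proof. by apply: sumr_ge0 => i _; rewrite -expr2 sqr_ge0. Qed.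

Lemma enorm_ge0 u : 0 <= enorm u.
Proof. exact: sqrtr_ge0. Qed.

Lemma sqr_enorm u : enorm u ^+ 2 = edot u u.
Proof. by rewrite sqr_sqrtr ?edot_ge0. Qed.

Lemma eucl_dist_ge0 x y : 0 <= eucl_dist x y.
Proof. exact: enorm_ge0. Qed.

Lemma eucl_distC x y : eucl_dist x y = eucl_dist y x.
Proof.
rewrite /eucl_dist /enorm; congr Num.sqrt; apply: eq_bigr => i _.
by rewrite !mxE; ring.
Qed.

Lemma eucl_dist_gt0_neq x y : 0 < eucl_dist x y -> x <> y.
Proof.
move=> + xy; rewrite xy /eucl_dist /enorm subrr /edot big1 ?sqrtr0 ?ltxx//.
by move=> i _; rewrite mxE mul0r.
Qed.

(* The parallelogram inequality |a + b|^2 <= 2|a|^2 + 2|b|^2 replaces the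
   triangle inequality here. *)
Lemma eucl_dist_le2 c x y (r : R) : eclosed_ball c r x -> eclosed_ball c r y ->
  eucl_dist x y <= 2 * r.
Proof.
rewrite /eclosed_ball /= => hx hy.
have r0 : 0 <= r := le_trans (eucl_dist_ge0 c x) hx.
rewrite -(ler_pXn2r (isT : (0 < 2)%N)) ?nnegrE ?mulr_ge0 ?eucl_dist_ge0//.
have sq z : eucl_dist c z <= r -> edot (c - z) (c - z) <= r ^+ 2.
  by move=> hz; rewrite -sqr_enorm lerXn2r ?nnegrE ?eucl_dist_ge0.
have := sq _ hx; have := sq _ hy; rewrite /eucl_dist sqr_enorm => h1 h2.
suff : edot (x - y) (x - y) <=
    2 * edot (c - x) (c - x) + 2 * edot (c - y) (c - y) by nra.
rewrite /edot !mulr_sumr -big_split /=; apply: ler_sum => i _.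
rewrite !mxE -subr_ge0; set a := c _ _; set b := x _ _; set e := y _ _.
(* By the parallelogram law the defect is the square of [(a - b) + (a - e)]. *)
rewrite (_ : _ - _ = (2 * a - b - e) ^+ 2); first exact: sqr_ge0.
by ring.
Qed.

(** The law of cosines, through which angles depend on side lengths alone. *)
Lemma edot_polar x y z : edot (y - x) (z - x) =
  (eucl_dist x y ^+ 2 + eucl_dist x z ^+ 2 - eucl_dist y z ^+ 2) / 2.
Proof.
rewrite /eucl_dist !sqr_enorm /edot -big_split/= -sumrB mulr_suml.
by apply: eq_bigr => i _; rewrite !mxE; field.
Qed.

Lemma angleE x y z : angle (y - x) (z - x) =
  acos ((eucl_dist x y ^+ 2 + eucl_dist x z ^+ 2 - eucl_dist y z ^+ 2) / 2
    / (eucl_dist x y * eucl_dist x z)).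
Proof.
by rewrite /angle edot_polar (eucl_distC x y) (eucl_distC x z).
Qed.

Lemma bounded_set_subset_ball (A : set 'rV[R]_n) : bounded_set A ->
  exists2 r : R, 0 < r & A `<=` eclosed_ball 0 r.
Proof.
move=> [M [_ HM]].
have [N N0 bN] : exists2 N, 0 < N & M < N.
  by exists (`|M| + 1); [rewrite ltr_wpDl|have := ler_norm M; lra].
(* [N] bounds the sup norm. This radius avoids the square root of [n], and the added 1 keeps it
   positive in dimension 0. *)
exists (n%:R * N + 1); first by rewrite ltr_wpDl// mulr_ge0// ltW.
move=> x Ax; rewrite /eclosed_ball/= eucl_distC /eucl_dist subr0.
have xi i : `|x ord0 i| <= N.
  have := HM N bN x Ax; apply: le_trans.
  rewrite [leRHS]mx_normrE.
  exact: (@le_bigmax _ _ _ _ (fun ij => `|x ij.1 ij.2|) (ord0, i)).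
rewrite -(ler_pXn2r (isT : (0 < 2)%N)) ?nnegrE ?enorm_ge0//; last first.
  by rewrite addr_ge0// mulr_ge0// ltW.
rewrite sqr_enorm.
apply: (@le_trans _ _ (n%:R * N ^+ 2)).
  rewrite -[n in leRHS]card_ord -sum1_card natr_sum mulr_suml.
  apply: ler_sum => i _; rewrite mul1r -expr2 -real_normK ?num_real//.
  by rewrite lerXn2r ?nnegrE// ltW.
have n2 : n%:R <= n%:R ^+ 2 :> R by rewrite -natrX ler_nat -[leqLHS]muln1; case: (n) => // m; rewrite leq_mul2l.
have n0 : 0 <= n%:R :> R by [].
have : 0 < N ^+ 2 by exact: exprn_gt0.
rewrite sqrrD1 exprMn => N2.
have : n%:R * N ^+ 2 <= n%:R ^+ 2 * N ^+ 2 by rewrite ler_pM2r.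
have : 0 <= n%:R * N by rewrite mulr_ge0// ltW.
lra.
Qed.

End euclidean.

(** * Cosine and arccosine near pi/3 *)

Section cosine_pi3.
Context (R : realType).

(** Expanding [cos pi] as the cosine of a tripled angle gives [4c^3 - 3c + 1 = 0], that is
    [(c + 1)(2c - 1)^2 = 0], and [c > 0] leaves 1/2. *)
Lemma cos_pi3 : cos (pi / 3) = 2^-1 :> R.
Proof.
have p0 := @pi_gt0 R; set c := cos (pi / 3).
have c0 : 0 < c by apply: cos_gt0_pihalf; apply/andP; split; lra.
have e3 : pi = pi / 3 *+ 2 + pi / 3 :> R by rewrite mulr2n; field.
have := @cospi R; rewrite {1}e3 cosD cos_mulr2n sin_mulr2n -/c.
have s2 : sin (pi / 3) ^+ 2 = 1 - c ^+ 2 by rewrite sin2cos2.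
set s := sin (pi / 3) in s2 * => E.
have : (c + 1) * (2 * c - 1) ^+ 2 = 0.
  have -> : (c + 1) * (2 * c - 1) ^+ 2 =
    ((c ^+ 2 *+ 2 - 1) * c - (c * s) *+ 2 * s) + 1
    + 2 * c * (s ^+ 2 - (1 - c ^+ 2)) by ring.
  by rewrite E s2; ring.
move/eqP; rewrite mulf_eq0 sqrf_eq0 => /orP[|] /eqP; lra.
Qed.

(** Lower bound for the steepness of the cosine on [[pi/12, 11pi/12]], an interval that contains
    [pi/3 - d] and [pi/3 + d] whenever [0 < d <= 1/2]. *)
Definition sin_pi12 : R := sin (pi / 12).

Lemma sin_pi12_gt0 : 0 < sin_pi12.
Proof. by have := @pi_gt0 R => p0; apply: sin_gt0_pi; apply/andP; split; lra. Qed.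

Lemma sin_ge_sin_pi12 (x : R) : pi / 12 <= x <= pi - pi / 12 ->
  sin_pi12 <= sin x.
Proof.
have p0 := @pi_gt0 R; move=> /andP[x1 x2]; rewrite /sin_pi12 leNgt.
have [xh|xh] := leP x (pi / 2).
  by rewrite ltr_sin ?in_itv/=; [lra|apply/andP; split; lra..].
have -> : sin x = sin (pi - x) by rewrite sinB sinpi cospi; ring.
by rewrite ltr_sin ?in_itv/=; [lra|apply/andP; split; lra..].
Qed.

(** The mean value theorem, with the sine at least [sin_pi12] at the intermediate point. *)
Lemma cos_drop (a b : R) : pi / 12 <= a -> a <= b -> b <= pi - pi / 12 ->
  sin_pi12 * (b - a) <= cos a - cos b.
Proof.
move=> ha ab hb.
have der x : x \in `]a, b[ -> is_derive x 1 cos (- sin x).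
  by move=> _; exact: is_derive_cos.
have cont : {within `[a, b], continuous (@cos R)}.
  by apply: continuous_subspaceT => x; exact: continuous_cos.
have [c] := MVT_segment ab der cont.
rewrite in_itv/= => /andP[ca cb] E.
have := @sin_ge_sin_pi12 c; rewrite (le_trans ha ca) (le_trans cb hb) => /(_ isT).
by have : 0 <= b - a by [lra]; nra.
Qed.

(** By [cos_drop] the cosine of [pi / 3 - d] is at least [1/2 + sin_pi12 * d], which exceeds [w];
    the cosine decreases on [[0, pi]]. [acos_above] is the mirror image. *)
Lemma acos_below (k d w : R) : 0 < d <= 2^-1 -> k * 4 < sin_pi12 * d ->
  2^-1 <= w <= 2^-1 + 2 * k ->
  pi / 3 - d < acos w <= pi / 3.
Proof.
move=> /andP[d0 d1] kd /andP[w1 w2]; have p2 := @pi_ge2 R.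
have sd : sin_pi12 * d <= d by rewrite ger_pMl// sin_le1.
have w11 : -1 <= w <= 1 by apply/andP; split; lra.
have a0 := acos_ge0 w11; have ap := acos_lepi w11.
have ca : cos (acos w) = w by rewrite acosK// in_itv.
have drop := @cos_drop (pi / 3 - d) (pi / 3).
rewrite cos_pi3 in drop.
apply/andP; split.
  rewrite -(@ltr_cos R) ?in_itv/= ?ca; [|apply/andP; split; lra..].
  have := drop; lra.
rewrite leNgt -(@ltr_cos R) ?in_itv/= ?ca ?cos_pi3 -?leNgt; [|apply/andP; split; lra..].
lra.
Qed.

Lemma acos_above (k d w : R) : 0 < d <= 2^-1 -> k * 4 < sin_pi12 * d ->
  2^-1 - 2 * k <= w <= 2^-1 ->
  pi / 3 <= acos w < pi / 3 + d.
Proof.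
move=> /andP[d0 d1] kd /andP[w1 w2]; have p2 := @pi_ge2 R.
have sd : sin_pi12 * d <= d by rewrite ger_pMl// sin_le1.
have w11 : -1 <= w <= 1 by apply/andP; split; lra.
have a0 := acos_ge0 w11; have ap := acos_lepi w11.
have ca : cos (acos w) = w by rewrite acosK// in_itv.
have drop := @cos_drop (pi / 3) (pi / 3 + d).
rewrite cos_pi3 in drop.
apply/andP; split.
  rewrite leNgt -(@ltr_cos R) ?in_itv/= ?ca ?cos_pi3 -?leNgt; [|apply/andP; split; lra..].
  lra.
rewrite -(@ltr_cos R) ?in_itv/= ?ca; [|apply/andP; split; lra..].
have := drop; lra.
Qed.
End cosine_pi3.

(** * Nearly equilateral triangles *)

Section triangle.
Context (R : realType) (n : nat).
Implicit Types (x y z : 'rV[R]_n) (A : set 'rV[R]_n) (k d : R).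

(** The length [p] need not be a side: in use it is the lower end of a colour class. *)
Definition near_equilateral k A := exists x y z p, [/\ A x, A y & A z] /\
  [/\ 0 < p, p <= eucl_dist x y <= (1 + k) * p,
      p <= eucl_dist x z <= (1 + k) * p & p <= eucl_dist y z <= (1 + k) * p].

(** The quotient equals [1/2 + ((c - b)^2 + cb - a^2) / (2cb)]. The inner numerator is nonnegative
    because [a] is shortest, and at most [(2k + 2k^2)a^2 <= 4k cb] because [k <= 1]. *)
Lemma cosine_opposite_shortest k (a b c : R) : 0 <= k <= 1 -> 0 < a ->
  a <= b <= (1 + k) * a -> a <= c <= (1 + k) * a ->
  2^-1 <= (c ^+ 2 + b ^+ 2 - a ^+ 2) / 2 / (c * b) <= 2^-1 + 2 * k.
Proof.
move=> /andP[k0 k1] a0 /andP[ab ba] /andP[ac ca].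
have cb0 : 0 < c * b by apply: mulr_gt0; lra.
have cba : a * a <= c * b by apply: ler_pM; lra.
have cba' : c * b <= ((1 + k) * a) * ((1 + k) * a) by apply: ler_pM; lra.
have c2 : (c - b) ^+ 2 <= (k * a) ^+ 2.
  rewrite -real_normK ?num_real// lerXn2r ?nnegrE ?mulr_ge0 ?(ltW a0)//.
  by rewrite ler_norml; apply/andP; split; lra.
have kcb : k * (a * a) <= k * (c * b) by rewrite ler_wpM2l.
have kka : k * (k * (a * a)) <= k * (a * a).
  by rewrite ler_wpM2l// ler_piMl// mulr_ge0// ltW.
have := sqr_ge0 (c - b); rewrite ler_pdivlMr// ler_pdivrMr// => c2'.
rewrite !expr2 in c2 c2' *.
apply/andP; split; lra.
Qed.

(** The lower bound uses the same decomposition with [a^2 <= (1 + k)^2 cb]. For the upper bound,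
    [a^2] dominates the square of the longer of [b] and [c], and [cb] that of the shorter. *)
Lemma cosine_opposite_longest k (a b c : R) : 0 <= k <= 1 -> 0 < b -> 0 < c ->
  b <= a <= (1 + k) * b -> c <= a <= (1 + k) * c ->
  2^-1 - 2 * k <= (c ^+ 2 + b ^+ 2 - a ^+ 2) / 2 / (c * b) <= 2^-1.
Proof.
move=> /andP[k0 k1] b0 c0 /andP[ba ab] /andP[ca ac].
have cb0 : 0 < c * b by apply: mulr_gt0.
have aa : a * a <= ((1 + k) * c) * ((1 + k) * b) by apply: ler_pM; lra.
have kk : k * (k * (c * b)) <= k * (c * b).
  by rewrite ler_wpM2l// ler_piMl// ltW.
have cc : c * c <= a * a by apply: ler_pM; lra.
have bb : b * b <= a * a by apply: ler_pM; lra.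
have up : c * c + b * b - a * a <= c * b.
  have [cb|/ltW bc] := leP c b.
    by have : c * c <= c * b by [rewrite ler_pM2l]; lra.
  by have : b * b <= c * b by [rewrite ler_pM2r]; lra.
have := sqr_ge0 (c - b); rewrite ler_pdivlMr// ler_pdivrMr// => c2'.
rewrite !expr2 in c2' *.
apply/andP; split; lra.
Qed.

Lemma near_equilateral_angles k d A : 0 < d <= 2^-1 -> 0 <= k ->
  k * 4 < sin_pi12 R * d -> near_equilateral k A ->
  (exists theta, pi / 3 - d < theta <= pi / 3 /\ contains_angle A theta) /\
  (exists theta, pi / 3 <= theta < pi / 3 + d /\ contains_angle A theta).
Proof.
move=> d1 k0 kd [x [y [z [p [[Ax Ay Az] [p0 xy xz yz]]]]]].
have k1 : 0 <= k <= 1.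
  case/andP: (d1) => d0 dh; rewrite k0.
  have sd : sin_pi12 R * d <= d by rewrite ger_pMl// sin_le1.
  lra.
(* The angle at [u] when the opposite side is shortest; in [high] that side is longest. The closing
   case analysis finds such a vertex. *)
have low u v w : A u -> A v -> A w ->
    p <= eucl_dist u v <= (1 + k) * p -> p <= eucl_dist u w <= (1 + k) * p ->
    p <= eucl_dist v w <= (1 + k) * p ->
    eucl_dist v w <= eucl_dist u v -> eucl_dist v w <= eucl_dist u w ->
    exists theta, pi / 3 - d < theta <= pi / 3 /\ contains_angle A theta.
  move=> Au Av Aw /andP[uv1 uv2] /andP[uw1 uw2] /andP[vw1 vw2] h1 h2.
  exists (angle (v - u) (w - u)); split.
    (* This turns the upper bounds relative to [p] into bounds relative to the shortest side. *)
    have pk : (1 + k) * p <= (1 + k) * eucl_dist v w by rewrite ler_wpM2l//; lra.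
    rewrite angleE; apply: (acos_below d1 kd).
    by apply: cosine_opposite_shortest => //; [|apply/andP; split..]; lra.
  exists u, v, w; split => //; split => //.
  by split; apply: eucl_dist_gt0_neq; lra.
have high u v w : A u -> A v -> A w ->
    p <= eucl_dist u v <= (1 + k) * p -> p <= eucl_dist u w <= (1 + k) * p ->
    p <= eucl_dist v w <= (1 + k) * p ->
    eucl_dist u v <= eucl_dist v w -> eucl_dist u w <= eucl_dist v w ->
    exists theta, pi / 3 <= theta < pi / 3 + d /\ contains_angle A theta.
  move=> Au Av Aw /andP[uv1 uv2] /andP[uw1 uw2] /andP[vw1 vw2] h1 h2.
  exists (angle (v - u) (w - u)); split.
    have pk : (1 + k) * p <= (1 + k) * eucl_dist u v by rewrite ler_wpM2l//; lra.
    have pk' : (1 + k) * p <= (1 + k) * eucl_dist u w by rewrite ler_wpM2l//; lra.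
    rewrite angleE; apply: (acos_above d1 kd).
    by apply: cosine_opposite_longest => //; [| |apply/andP; split..]; lra.
  exists u, v, w; split => //; split => //.
  by split; apply: eucl_dist_gt0_neq; lra.
have yx : eucl_dist y x = eucl_dist x y := eucl_distC y x.
have zx : eucl_dist z x = eucl_dist x z := eucl_distC z x.
have zy : eucl_dist z y = eucl_dist y z := eucl_distC z y.
split.
  have [h1|/ltW h1] := leP (eucl_dist y z) (eucl_dist x y).
    have [h2|/ltW h2] := leP (eucl_dist y z) (eucl_dist x z).
      exact: (low x y z).
    by apply: (low y x z); rewrite ?yx//; lra.
  have [h2|/ltW h2] := leP (eucl_dist x y) (eucl_dist x z).
    by apply: (low z x y); rewrite ?zx ?zy//; lra.
  by apply: (low y x z); rewrite ?yx//; lra.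
have [h1|/ltW h1] := leP (eucl_dist x y) (eucl_dist y z).
  have [h2|/ltW h2] := leP (eucl_dist x z) (eucl_dist y z).
    exact: (high x y z).
  by apply: (high y x z); rewrite ?yx//; lra.
have [h2|/ltW h2] := leP (eucl_dist x z) (eucl_dist x y).
  by apply: (high z x y); rewrite ?zx ?zy//; lra.
by apply: (high y x z); rewrite ?yx//; lra.
Qed.

End triangle.

(** * Covers by balls and packings *)

Section covering.
Context (R : realType) (n : nat).
Implicit Types (x y z : 'rV[R]_n) (A B : set 'rV[R]_n) (k r : R).

(** Centres may lie outside [B] and only the first [N] terms count; a total sequence lets covers be
    composed by index arithmetic. *)
Definition covered_by B (N : nat) r := exists c : nat -> 'rV[R]_n,
  forall x, B x -> exists2 i, (i < N)%N & eclosed_ball (c i) r x.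

(** Greedy choice: if [r]-balls around at most [N] chosen points always miss a point of [B], that
    point can be added, until [N + 1] points more than [r] apart contradict the hypothesis. *)
Lemma separated_cover B N r :
  (forall f : 'I_N.+1 -> 'rV[R]_n, (forall i, B (f i)) ->
     exists i j, i != j /\ eucl_dist (f i) (f j) <= r) ->
  covered_by B N r.
Proof.
move=> close; apply: contrapT => nocov.
have sep m : (m <= N.+1)%N -> exists f : nat -> 'rV[R]_n,
    (forall i, (i < m)%N -> B (f i)) /\
    (forall i j, (i < m)%N -> (j < m)%N -> i != j -> r < eucl_dist (f i) (f j)).
  elim: m => [_|m IH lemN]; first by exists (fun=> 0).
  have [f [fB fsep]] := IH (ltnW lemN).
  have [x [Bx farx]] : exists x, B x /\
      forall i, (i < m)%N -> r < eucl_dist (f i) x.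
    apply: contrapT => nox; apply: nocov; exists f => x Bx.
    apply: contrapT => noi; apply: nox; exists x; split => // i im.
    rewrite ltNge; apply/negP => fix_; apply: noi; exists i => //.
    exact: leq_trans im _.
  exists (fun i => if i == m then x else f i); split.
    by move=> i; rewrite ltnS; case: eqVneq => // im lim; apply: fB; lia.
  move=> i j li lj; case: (eqVneq i m) => [->|im]; case: (eqVneq j m) => [jm|jm] //= ij.
  - by rewrite eucl_distC; apply: farx; lia.
  - by apply: farx; lia.
  - by apply: fsep => //; lia.
have [f [fB fsep]] := sep _ (leqnn _).
have [i|i [j [ij]]] := close (fun i : 'I_N.+1 => f i); first exact: fB.
by apply/negP; rewrite -ltNge fsep.
Qed.

Lemma geometric_class k p d (K : nat) : (0 < K)%N ->
  p <= d <= (1 + k) ^+ K * p ->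
  exists j : 'I_K, (1 + k) ^+ j * p <= d <= (1 + k) ^+ j.+1 * p.
Proof.
case: K => // K _; elim: K => [|K IH] /andP[pd dp].
  by exists ord0; rewrite expr0 mul1r pd dp.
have [dK|/ltW dK] := leP d ((1 + k) ^+ K.+1 * p); last first.
  by exists ord_max; rewrite dK dp.
by have [|j jP] := IH; [rewrite pd dK|exists (widen_ord (leqnSn _) j)].
Qed.

(** The 4 is the ratio of the largest possible distance [2 * r] to the separation [r / 2], so [K]
    geometric classes of ratio [1 + k] catch all distances. *)
Lemma half_cover A k (K : nat) : 0 <= k -> 4 <= (1 + k) ^+ K ->
  ~ near_equilateral k A ->
  forall c r, 0 < r ->
  covered_by (A `&` eclosed_ball c r) (K.+1 ^ K) (r / 2).
Proof.
move=> k0 K4 nonear c r r0; apply: separated_cover => f fA.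
have K0 : (0 < K)%N.
  by case: K K4 {f fA} => //; rewrite expr0; lra.
apply: contrapT => noclose.
have sep i j : i != j -> r / 2 < eucl_dist (f i) (f j).
  by move=> ij; rewrite ltNge; apply/negP => h; apply: noclose; exists i, j.
have class i j : exists l : 'I_K, i != j ->
    (1 + k) ^+ l * (r / 2) <= eucl_dist (f i) (f j)
      <= (1 + k) ^+ l.+1 * (r / 2).
  (* The diagonal gets an arbitrary colour. *)
  have [->|ij] := eqVneq i j; first by exists (Ordinal K0).
  have [|l lP] := @geometric_class k (r / 2) (eucl_dist (f i) (f j)) K K0.
    rewrite (ltW (sep _ _ ij))/=.
    apply: (le_trans (eucl_dist_le2 (fA i).2 (fA j).2)).
    have -> : 2 * r = 4 * (r / 2) by field.
    by rewrite ler_pM2r ?divr_gt0.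
  by exists l.
pose col i := projT1 (choice (class i)).
have colP i j : i != j -> (1 + k) ^+ col i j * (r / 2)
    <= eucl_dist (f i) (f j) <= (1 + k) ^+ (col i j).+1 * (r / 2).
  exact: projT2 (choice (class i)) j.
have := @multicolor_ramsey_triangle _ K col [set: 'I_K]%SET [set: 'I_(K.+1 ^ K).+1]%SET.
rewrite !cardsT !card_ord ltnn => H.
suff : false by [].
apply: H => [x y _ _ _|x y z [xy xz yz] cxy cyz]; first by rewrite inE.
apply: nonear.
have := colP _ _ xy; have := colP _ _ xz; have := colP _ _ yz.
(* The lower end of the common colour class serves as [p] for all three sides. *)
rewrite cyz -cxy exprS -mulrA; set p := (1 + k) ^+ _ * _ => h1 h2 h3.
exists (f x), (f y), (f z), p; split; first by split; apply: (fA _).1.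
by split => //; rewrite mulr_gt0 ?divr_gt0// exprn_gt0//; lra.
Qed.

Lemma covered_byM B M N r s : (0 < N)%N ->
  covered_by B M r ->
  (forall c, covered_by (B `&` eclosed_ball c r) N s) ->
  covered_by B (M * N) s.
Proof.
move=> N0 [c cP] /choice[e eP].
(* Division by [N] decodes an index into an outer ball and a ball of its own cover. *)
exists (fun i => e (c (i %/ N)%N) (i %% N)%N) => x Bx.
have [i iM xi] := cP x Bx; have [j jN xj] := eP (c i) x (conj Bx xi).
exists (i * N + j)%N; first by nia.
by rewrite divnMDl// (divn_small jN) addn0 modnMDl (modn_small jN).
Qed.

Lemma iterated_cover A (M : nat) : (0 < M)%N ->
  (forall c r, 0 < r -> covered_by (A `&` eclosed_ball c r) M (r / 2)) ->
  forall c r j, 0 < r ->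
  covered_by (A `&` eclosed_ball c r) (M ^ j) (r / 2 ^+ j).
Proof.
move=> M0 half c r j r0; elim: j => [|j IH].
  by rewrite expr0 divr1; exists (fun=> c) => x [_ xr]; exists 0%N.
rewrite expnSr; apply: (covered_byM M0 IH) => b.
have [] := half b (r / 2 ^+ j); first by rewrite divr_gt0 ?exprn_gt0.
move=> e eP; exists e => x [[Ax _] xb]; have [i iM xi] := eP x (conj Ax xb).
exists i => //; suff <- : r / 2 ^+ j / 2 = r / 2 ^+ j.+1 by [].
by rewrite exprSr invfM mulrA.
Qed.

(** Pigeonhole: two packing centres in one [r]-ball are at most [2 * r <= eps] apart, so the second
    lies in both [eps]-balls. *)
Lemma packing_le_cover B (N m : nat) r eps : covered_by B N r -> 2 * r <= eps ->
  has_packing B eps m -> (m <= N)%N.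
Proof.
move=> [c cP] reps [x [xB xdisj]].
have nearest (i : 'I_m) : exists l : 'I_N, eclosed_ball (c l) r (x i).
  by have [l lN ?] := cP _ (xB i); exists (Ordinal lN).
have [g gP] := choice nearest.
have g_inj : injective g.
  move=> i j gij; apply/eqP; apply: contrapT => /negP ij.
  have : (eclosed_ball (x i) eps `&` eclosed_ball (x j) eps) (x j).
    have gPj : eclosed_ball (c (g i)) r (x j) by rewrite gij.
    have xixj := eucl_dist_le2 (gP i) gPj.
    split; first exact: le_trans reps.
    have : 0 <= eps by apply: le_trans (le_trans xixj reps); exact: eucl_dist_ge0.
    rewrite /eclosed_ball/= /eucl_dist subrr /enorm /edot big1 ?sqrtr0// => l _.
    by rewrite mxE mul0r.
  by rewrite xdisj.
by have := leq_card g g_inj; rewrite !card_ord.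
Qed.

End covering.

(** * Upper Minkowski dimension *)

Section minkowski.
Context (R : realType) (n : nat).
Implicit Types (A : set 'rV[R]_n) (t s r eps : R).

(** Take the least [j] with [2 * r / eps <= 2 ^+ j]: minimality gives the second bound, and
    [eps < r] settles [j = 0]. *)
Lemma dyadic_scale r eps : 0 < eps < r ->
  exists j : nat, 2 * (r / 2 ^+ j) <= eps /\ 2 ^+ j <= 4 * r / eps.
Proof.
move=> /andP[e0 er].
have ex : exists j : nat, 2 * r / eps <= 2 ^+ j.
  exists (Num.bound (2 * r / eps)); apply: ltW.
  exact: (upper_nthrootP (leqnn _)).
case: (ex_minnP ex) => j jP jmin; exists j; split.
  have p0 : 0 < 2 ^+ j :> R by rewrite exprn_gt0.
  by move: jP; rewrite mulrA ler_pdivrMr// ler_pdivrMr// [X in _ <= X -> _]mulrC.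
case: j jP jmin => [|j] _ jmin.
  by rewrite expr0 ler_pdivlMr// mul1r; lra.
have : 2 ^+ j < 2 * r / eps.
  by rewrite ltNge; apply/negP => /jmin; rewrite ltnn.
by rewrite ltr_pdivlMr// ler_pdivlMr// exprS; lra.
Qed.

Lemma natX_le_powR (M j : nat) t : M%:R <= 2 `^ t ->
  (M ^ j)%:R <= (2 ^+ j) `^ t :> R.
Proof.
move=> Mt; have -> : (2 ^+ j) `^ t = (2 `^ t) ^+ j :> R.
  by rewrite -!powR_mulrn ?powR_ge0// -!powRrM mulrC.
rewrite natrX.
by apply: lerXn2r; rewrite ?nnegrE ?powR_ge0.
Qed.

(** The packing number at scale [eps] is at most [M ^ j], hence at most [(4r / eps)^t]. For [s > t]
    its product with [eps^s] stays below a constant, so the upper limit cannot be infinite. *)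
Lemma upper_minkowski_dim_le A (M : nat) t r : 0 <= t -> M%:R <= 2 `^ t ->
  0 < r -> (forall j, covered_by A (M ^ j) (r / 2 ^+ j)) ->
  (upper_minkowski_dim A <= t%:E)%E.
Proof.
move=> t0 Mt r0 cov; apply: ge_ereal_sup => _ [s /= sE <-].
rewrite lee_fin leNgt; apply/negP => ts.
suff : (limf_esup (fun eps => packing_number A eps * (eps `^ s)%:E)%E
    (0 : R)^'+ <= ((4 * r) `^ t)%:E)%E by rewrite sE.
rewrite limf_esupE; apply: ge_ereal_inf.
(* [eps < r] serves [dyadic_scale], and [eps < 1] gives [eps^s <= eps^t]. *)
exists (ereal_sup [set (packing_number A eps * (eps `^ s)%:E)%E
  | eps in [set eps : R | 0 < eps < Num.min 1 r]]).
  exists [set eps : R | 0 < eps < Num.min 1 r] => //.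
  near=> e => /=; apply/andP; split; near: e; first exact: nbhs_right_gt.
  by apply: nbhs_right_lt; rewrite lt_min ltr01.
apply: ge_ereal_sup => _ [e /= eP <-].
move: eP; rewrite lt_min => /andP[e0 /andP[e1 er]].
have [|j [j1 j2]] := @dyadic_scale r e; first by rewrite e0.
have pack : (packing_number A e <= ((M ^ j)%:R)%:E)%E.
  apply: ge_ereal_sup => _ [m /= mP <-]; rewrite lee_fin ler_nat.
  exact: (packing_le_cover (cov j) j1 mP).
apply: (@le_trans _ _ ((M ^ j)%:R%:E * (e `^ s)%:E)%E).
  by apply: lee_wpmul2r => //; rewrite lee_fin powR_ge0.
rewrite -EFinM lee_fin.
apply: (@le_trans _ _ ((4 * r / e) `^ t * e `^ t)).
  apply: ler_pM; rewrite ?powR_ge0//.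
    apply: le_trans (natX_le_powR j Mt) _.
    by apply: ge0_ler_powR => //; rewrite nnegrE ?exprn_ge0 ?divr_ge0 ?mulr_ge0 ?ltW.
  by apply: ger_powR; rewrite ?e0 ?ltW.
by rewrite -powRM ?divr_ge0 ?mulr_ge0 ?(ltW e0) ?(ltW r0)// divfK// (gt_eqF e0).
Unshelve. all: by end_near. Qed.

End minkowski.

(** * Hausdorff measure and dimension *)

(** Tonelli for series; it merges countably many covers into the single sequence that
    [hausdorff_premeasure] asks for. *)
Lemma nneseries_pair_enum (R : realType) (f : nat -> nat * nat)
    (a : nat -> nat -> \bar R) : set_bij setT setT f ->
  (forall i j, 0 <= a i j)%E ->
  (\sum_(m <oo) a (f m).1 (f m).2 = \sum_(i <oo) \sum_(j <oo) a i j)%E.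
Proof.
move=> fbij a0.
rewrite nneseries_esumT//.
rewrite -(@reindex_esum R _ _ setT setT f (fun p => a p.1 p.2)) //.
rewrite nneseries_esumT; last by move=> i; apply: nneseries_ge0.
rewrite (_ : [set: nat * nat] = setT `*`` (fun=> setT)); last first.
  by apply/seteqP; split => // -[i j].
rewrite -(@esum_esum R _ _ setT (fun=> setT) a) //.
by apply: eq_esum => i _; rewrite nneseries_esumT.
Qed.

Section hausdorff.
Context (R : realType) (n : nat).
Implicit Types (A B U : set 'rV[R]_n) (t s r eps : R).

Lemma hausdorff_gauge_ge0 s U : (0 <= hausdorff_gauge s U)%E.
Proof. by rewrite /hausdorff_gauge; case: ifP => // _; exact: poweR_ge0. Qed.

Lemma ediam_sub_ball U c r : U `<=` eclosed_ball c r ->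
  (ediam U <= (2 * r)%:E)%E.
Proof.
move=> Ur; apply: ge_ereal_sup => _ [x [y [Ux Uy ->]]].
by rewrite lee_fin; apply: (@eucl_dist_le2 _ _ c); exact: Ur.
Qed.

Lemma hausdorff_gauge_sub_ball s U c r : 0 <= s -> 0 <= r ->
  U `<=` eclosed_ball c r -> (hausdorff_gauge s U <= ((2 * r) `^ s)%:E)%E.
Proof.
move=> s0 r0 Ur; rewrite /hausdorff_gauge; case: ifPn => [_|].
  by rewrite lee_fin powR_ge0.
move=> /set0P[x Ux]; rewrite -poweR_EFin; apply: gt0_ler_poweR => //.
- rewrite in_itv/= leey andbT; apply: le_ereal_sup_tmp.
  by exists (eucl_dist x x)%:E; [exists x, x|rewrite lee_fin eucl_dist_ge0].
- by rewrite in_itv/= leey andbT lee_fin mulr_ge0.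
- exact: (ediam_sub_ball Ur).
Qed.

(** The cost is at most [(2r)^s] times the [j]-th power of [2^(t - s) < 1], so it tends to 0. *)
Lemma small_cover_exists (M : nat) t s r eta eps : M%:R <= 2 `^ t -> t < s ->
  0 < r -> 0 < eta -> 0 < eps -> exists j : nat,
  2 * (r / 2 ^+ j) <= eta /\ (M ^ j)%:R * (2 * (r / 2 ^+ j)) `^ s <= eps.
Proof.
move=> Mt ts r0 eta0 eps0.
have half : `|2^-1 : R| < 1 by rewrite gtr0_norm ?invr_gt0// invf_lt1// ltr1n.
have q0 : 0 <= 2 `^ (t - s) :> R by exact: powR_ge0.
have q1 : `|2 `^ (t - s) : R| < 1.
  rewrite ger0_norm// /powR pnatr_eq0/= expR_lt1.
  by rewrite pmulr_llt0 ?ln_gt0 ?ltr1n// subr_lt0.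
have c1 := @cvg_geometric R (2 * r) _ half.
have c2 := @cvg_geometric R ((2 * r) `^ s) _ q1.
have n1 : \forall j \near \oo, geometric (2 * r) 2^-1 j < eta.
  exact: (cvgr_lt 0 c1).
have n2 : \forall j \near \oo, geometric ((2 * r) `^ s) (2 `^ (t - s)) j < eps.
  exact: (cvgr_lt 0 c2).
have [j [j1 j2]] := filter_ex (filterI n1 n2).
have pj : 2 * (r / 2 ^+ j) = geometric (2 * r) 2^-1 j.
  by rewrite /geometric/= exprVn mulrA.
exists j; split; first by rewrite pj ltW.
apply: le_trans (ltW j2); rewrite pj /geometric/=.
rewrite (@powRM _ (2 * r)) ?mulr_ge0 ?exprn_ge0 ?invr_ge0 ?(ltW r0)//.
rewrite mulrCA; apply: ler_wpM2l; first exact: powR_ge0.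
have -> : (2^-1 ^+ j) `^ s = (2 `^ (- s)) ^+ j :> R.
  rewrite -(powR_mulrn _ (powR_ge0 _ _)) -powRrM.
  have -> : 2^-1 ^+ j = 2 `^ (- j%:R) :> R by rewrite powRN powR_mulrn// exprVn.
  by rewrite -powRrM; congr (_ `^ _); ring.
rewrite natrX -exprMn; apply: lerXn2r; rewrite ?nnegrE ?mulr_ge0 ?powR_ge0//.
rewrite powRD ?pnatr_eq0 ?implybT//.
by apply: ler_wpM2r => //; exact: powR_ge0.
Qed.

Lemma finite_cover_gauge A (c : nat -> 'rV[R]_n) (N : nat) s r : 0 <= s -> 0 <= r ->
  (\sum_(l <oo) hausdorff_gauge s
      (if (l < N)%N then A `&` eclosed_ball (c l) r else set0)
    <= (N%:R * (2 * r) `^ s)%:E)%E.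
Proof.
move=> s0 r0.
rewrite (nneseries_split 0 N); last by move=> l _; exact: hausdorff_gauge_ge0.
(* From index [N] on the sets are empty, with gauge 0 even for [s = 0]. *)
rewrite add0n eseries0 ?adde0; last first.
  by move=> l; rewrite leqNgt => /negbTE -> _; rewrite /hausdorff_gauge eqxx.
have -> : (N%:R * (2 * r) `^ s)%:E = (\sum_(l < N) ((2 * r) `^ s)%:E)%E.
  by rewrite sumEFin sumr_const card_ord mulr_natl.
rewrite big_mkord; apply: lee_sum => l _; rewrite ltn_ord.
by apply: hausdorff_gauge_sub_ball => // x [].
Qed.

(** [A] may be unbounded, so its part in each ball of radius [i + 1] is covered at cost
    [e / 2^(i + 1)], and these covers are merged at total cost at most [e]. *)
Lemma hausdorff_measure_eq0 A (M : nat) t s : 0 <= t -> M%:R <= 2 `^ t -> t < s ->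
  (forall r j, 0 < r -> covered_by (A `&` eclosed_ball 0 r) (M ^ j) (r / 2 ^+ j)) ->
  hausdorff_measure s A = 0%E.
Proof.
move=> t0 Mt ts cov.
have s0 : 0 <= s by lra.
suff pre eta : 0 < eta -> hausdorff_premeasure s eta A = 0%E.
  apply/eqP; rewrite eq_le; apply/andP; split.
    by apply: ge_ereal_sup => _ [eta /= eta0 <-]; rewrite pre.
  by apply: le_ereal_sup_tmp; exists 0%E => //; exists 1 => //=; rewrite pre.
move=> eta0; apply/eqP; rewrite eq_le; apply/andP; split; last first.
  apply: le_ereal_inf_tmp => _ [U [_ _ ->]].
  by apply: nneseries_ge0 => l _ _; exact: hausdorff_gauge_ge0.
apply/lee_addgt0Pr => e e0; rewrite add0e.
have block (i : nat) : exists jc : nat * (nat -> 'rV[R]_n),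
    [/\ 2 * (i.+1%:R / 2 ^+ jc.1) <= eta,
        (M ^ jc.1)%:R * (2 * (i.+1%:R / 2 ^+ jc.1)) `^ s <= e / (2 ^ i.+1)%:R &
        forall x, (A `&` eclosed_ball 0 i.+1%:R) x ->
          exists2 l, (l < M ^ jc.1)%N & eclosed_ball (jc.2 l) (i.+1%:R / 2 ^+ jc.1) x].
  have e2 : 0 < e / (2 ^ i.+1)%:R by rewrite divr_gt0// ltr0n expn_gt0.
  have [j [j1 j2]] := small_cover_exists Mt ts (ltr0Sn R i) eta0 e2.
  have [c cP] := cov i.+1%:R j (ltr0Sn R i).
  by exists (j, c).
have [F FP] := choice block.
pose V i l := if (l < M ^ (F i).1)%N then
  A `&` eclosed_ball ((F i).2 l) (i.+1%:R / 2 ^+ (F i).1) else set0.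
have /card_set_bijP[f fbij] : ([set: nat] #= [set: nat * nat])%card.
  by rewrite card_eq_sym; exact: card_nat2.
apply: ge_ereal_inf.
exists (\sum_(m <oo) hausdorff_gauge s (V (f m).1 (f m).2))%E.
  exists (fun m => V (f m).1 (f m).2); split => //.
    (* Truncating the distance to the origin selects a ball that contains [x]. *)
    move=> x Ax; pose i := Num.trunc (eucl_dist 0 x).
    have xi : (A `&` eclosed_ball 0 i.+1%:R) x.
      by split => //; rewrite /eclosed_ball/= ltW// truncnS_gt.
    have [_ _ /(_ x xi)[l lM xl]] := FP i.
    have [_ _ fsurj] := fbij.
    have [m _ fm] := fsurj (i, l) I.
    by exists m => //; rewrite fm /V /= lM.
  move=> m; rewrite /V; case: ifP => _.
    have [h _ _] := FP (f m).1.
    apply: (@le_trans _ _ (2 * ((f m).1.+1%:R / 2 ^+ (F (f m).1).1))%:E).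
      by apply: (@ediam_sub_ball _ ((F (f m).1).2 (f m).2)) => x [].
    by rewrite lee_fin.
  by apply: ge_ereal_sup => d [x [y [[]]]].
rewrite (nneseries_pair_enum (a := fun i l => hausdorff_gauge s (V i l)) fbij); last first.
  by move=> i j; exact: hausdorff_gauge_ge0.
apply: (@le_trans _ _ (\sum_(i <oo) (e / (2 ^ i.+1)%:R)%:E)%E); last first.
  exact: (epsilon_trick0 xpredT (ltW e0)).
apply: lee_nneseries => [i _ _|i _].
  by apply: nneseries_ge0 => l _ _; exact: hausdorff_gauge_ge0.
have [_ h _] := FP i.
apply: le_trans (_ : _ <= ((M ^ (F i).1)%:R * (2 * (i.+1%:R / 2 ^+ (F i).1)) `^ s)%:E)%E _.
  by apply: finite_cover_gauge => //; rewrite divr_ge0.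
by rewrite lee_fin.
Qed.

Lemma hausdorff_dim_le A (M : nat) t : 0 <= t -> M%:R <= 2 `^ t ->
  (forall r j, 0 < r -> covered_by (A `&` eclosed_ball 0 r) (M ^ j) (r / 2 ^+ j)) ->
  (hausdorff_dim A <= t%:E)%E.
Proof.
move=> t0 Mt cov; apply/lee_addgt0Pr => e e0; rewrite -EFinD.
apply: ereal_inf_lbound; exists (t + e) => //; split; first by lra.
by apply: (hausdorff_measure_eq0 t0 Mt _ cov); lra.
Qed.

End hausdorff.

(** * Choice of the constants and the exponent *)

Section exponent.
Context (R : realType).

Lemma bernoulli_le (k : R) (K : nat) : 0 <= k -> 1 + K%:R * k <= (1 + k) ^+ K.
Proof.
move=> k0; elim: K => [|K IH]; first by rewrite mul0r addr0 expr0.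
rewrite exprS -natr1.
have : (1 + k) * (1 + K%:R * k) <= (1 + k) * (1 + k) ^+ K.
  by rewrite ler_wpM2l//; lra.
have : 0 <= K%:R * (k * k) by rewrite mulr_ge0// mulr_ge0.
lra.
Qed.

(** With [k = sin_pi12 * delta / 16] and [K] just above [3 / k], Bernoulli gives [(1 + k)^K > 4].
    The 50 is 48 from [3 / k] plus 2 for rounding and the successor, as [sin_pi12 * delta <= 1]. *)
Lemma color_count (delta : R) : 0 < delta < 1 -> exists (k : R) (K : nat),
  [/\ 0 <= k, k * 4 < sin_pi12 R * (delta / 2), 4 <= (1 + k) ^+ K
    & K.+1%:R <= 50 / sin_pi12 R / delta].
Proof.
move=> /andP[d0 d1]; have s0 := @sin_pi12_gt0 R.
have s1 : sin_pi12 R <= 1 by exact: sin_le1.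
have sd0 : 0 < sin_pi12 R * delta by rewrite mulr_gt0.
have sd1 : sin_pi12 R * delta <= 1 by rewrite mulr_ile1// ltW.
set k := sin_pi12 R * delta / 16; set K := (Num.trunc (3 / k)).+1.
have k0 : 0 < k by rewrite divr_gt0.
have K3 : 3 < K%:R * k.
  by rewrite -ltr_pdivrMr// truncnS_gt.
exists k, K; split; first exact: ltW.
- by rewrite /k; lra.
- by have := bernoulli_le K (ltW k0); lra.
- have k3 : 0 <= 3 / k by rewrite divr_ge0// ltW.
  have /andP[Kk _] := truncn_itv k3.
  have -> : K.+1%:R = (Num.trunc (3 / k))%:R + 2 :> R by rewrite -natrD addn2.
  have E : 3 / k = 48 / (sin_pi12 R * delta).
    by rewrite /k; field; rewrite !gt_eqF.
  have -> : 50 / sin_pi12 R / delta = 50 / (sin_pi12 R * delta).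
    by field; rewrite !gt_eqF.
  have : 2 <= 2 / (sin_pi12 R * delta) by rewrite ler_pdivlMr//; lra.
  have -> : 50 / (sin_pi12 R * delta) =
    48 / (sin_pi12 R * delta) + 2 / (sin_pi12 R * delta) by field; rewrite !gt_eqF.
  lra.
Qed.

(** After taking logarithms, both [K] and [K.+1] are bounded by [a * x]. *)
Lemma natX_le_powR2 (K : nat) (a x T : R) : 0 < a -> 0 < x ->
  K.+1%:R <= a * x -> a * x * (ln a + ln x) <= T * ln 2 ->
  (K.+1 ^ K)%:R <= 2 `^ T.
Proof.
move=> a0 x0 Kax axT.
have lnK0 : 0 <= ln (K.+1%:R : R) by rewrite ln_ge0// ler1n.
rewrite /powR pnatr_eq0/= natrX -[X in X ^+ _ <= _]lnK ?posrE// -expRM_natl.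
rewrite ler_expR; apply: le_trans axT; rewrite -lnM ?posrE//.
apply: ler_pM => //; first by apply: le_trans Kax; rewrite ler_nat.
by rewrite ler_ln ?posrE ?mulr_gt0.
Qed.

(** The term [ln a] is absorbed into a multiple of [ln (1 / delta)], which is at least
    [ln (1 / delta0) > 0]; this is how [C] comes to depend on [delta0]. *)
Lemma exponent_bound (delta0 : R) : 0 < delta0 < 1 ->
  exists C : R, forall delta : R, 0 < delta <= delta0 ->
  0 <= C / delta * ln (1 / delta) /\
  exists (k : R) (K : nat),
  [/\ 0 <= k, k * 4 < sin_pi12 R * (delta / 2), 4 <= (1 + k) ^+ K
    & (K.+1 ^ K)%:R <= 2 `^ (C / delta * ln (1 / delta))].
Proof.
move=> /andP[d0 d01].
have s0 := @sin_pi12_gt0 R; have s1 : sin_pi12 R <= 1 by exact: sin_le1.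
set a := 50 / sin_pi12 R.
have a1 : 1 <= a by rewrite /a ler_pdivlMr//; lra.
have la0 : 0 <= ln a by rewrite ln_ge0.
have L0 : 0 < ln (1 / delta0) by rewrite ln_gt0// ltr_pdivlMr// mul1r.
have l2 : 0 < ln 2 :> R by rewrite ln_gt0// ltr1n.
exists (a * (ln a / ln (1 / delta0) + 1) / ln 2) => delta /andP[d dle].
have Lle : ln (1 / delta0) <= ln (1 / delta).
  by rewrite ler_ln ?posrE ?divr_gt0// !div1r lef_pV2 ?posrE.
have L : 0 < ln (1 / delta) by lra.
have C0 : 0 <= a * (ln a / ln (1 / delta0) + 1) / ln 2.
  rewrite divr_ge0 ?(ltW l2)// mulr_ge0//; first by lra.
  by rewrite addr_ge0// divr_ge0// ltW.
split; first exact: mulr_ge0 (divr_ge0 C0 (ltW d)) (ltW L).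
have [|k [K [k0 k4 K4 Ka]]] := @color_count delta; first by rewrite d; lra.
exists k, K; split => //.
apply: (@natX_le_powR2 K a (1 / delta)).
- lra.
- by rewrite divr_gt0.
- by rewrite mulrA mulr1.
have -> : a * (ln a / ln (1 / delta0) + 1) / ln 2 / delta * ln (1 / delta) * ln 2
    = a * (1 / delta) * (ln a / ln (1 / delta0) * ln (1 / delta) + ln (1 / delta)).
  by field; rewrite !gt_eqF.
have ad : 0 <= a * (1 / delta) by rewrite mulr_ge0 ?divr_ge0 ?(ltW d)//; lra.
rewrite ler_wpM2l//.
have q1 : 1 <= ln (1 / delta) / ln (1 / delta0).
  by rewrite ler_pdivlMr//; lra.
by rewrite lerD2r mulrAC -mulrA ler_peMr.
Qed.

End exponent.

Theorem corollary4p7 (R : realType) (delta0 : R) (hdelta0 : 0 < delta0 < 1) :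
  exists C : R, forall delta : R, 0 < delta <= delta0 ->
    (forall (n : nat) (A : set 'rV[R]_n),
       bounded_set A ->
       ((C / delta * ln (1 / delta))%:E < upper_minkowski_dim A)%E ->
       (exists theta : R,
          pi / 3 - delta < theta <= pi / 3 /\ contains_angle A theta) /\
       (exists theta : R,
          pi / 3 <= theta < pi / 3 + delta /\ contains_angle A theta)) /\
    (Ctilde (pi / 3) delta <= (C / delta * ln (1 / delta))%:E)%E.
Proof.
have [C CP] := exponent_bound hdelta0; exists C => delta hdelta.
have [T0 [k [K [k0 k4 K4 MT]]]] := CP delta hdelta.
have [d d1] : 0 < delta /\ delta < 1 by lra.
have angles n (A : set 'rV[R]_n) : near_equilateral k A ->
    (exists theta : R,
       pi / 3 - delta < theta <= pi / 3 /\ contains_angle A theta) /\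
    (exists theta : R,
       pi / 3 <= theta < pi / 3 + delta /\ contains_angle A theta).
  (* The arccosine estimates require a tolerance of at most 1/2, while [delta] is only below 1. *)
  have hd : 0 < delta / 2 <= 2^-1 by lra.
  move=> /(near_equilateral_angles hd k0 k4)[[u [uP Au]] [v [vP Av]]].
  by split; [exists u|exists v]; split => //; lra.
have cover n (A : set 'rV[R]_n) : ~ near_equilateral k A -> forall r j, 0 < r ->
    covered_by (A `&` eclosed_ball 0 r) ((K.+1 ^ K) ^ j) (r / 2 ^+ j).
  move=> nonear r j; apply: iterated_cover; first by rewrite expn_gt0.
  exact: half_cover K4 nonear.
split=> [n A bA dimA|].
  apply: angles; apply: contrapT => nonear.
  have [r r0 Ar] := bounded_set_subset_ball bA.
  move: dimA; apply/negP; rewrite -leNgt.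
  apply: (upper_minkowski_dim_le T0 MT r0) => j.
  by have := cover n A nonear r j r0; rewrite setIidl.
apply: ge_ereal_sup => _ [n [A [noangle ->]]].
apply: (hausdorff_dim_le T0 MT) => r j r0; apply: cover => // nearA.
(* The angle that is at most [pi / 3] already lies in the excluded open interval. *)
have [[u [uP Au]] _] := angles n A nearA.
by apply: (noangle u) => //; lra.
Qed.
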